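(* The following isomorphisms hold as root systems (that is, in each case there is a linear isomorphism of the ambient vector spaces mapping the first set of roots onto the second): $$R(BC_l^{(1,2)})\cong R(BC_l^{(2,1)}),\qquad R(BC_l^{(4,2)})\cong R(BC_l^{(2,4)})\qquad(l\ge1),$$ $$R(BC_l^{(2,2)\sigma}(i))\cong R(BC_l^{(2,2)}(i))\qquad (i\in\{1,2\};\ l\ge2\text{ if } i=1,\ l\ge1\text{ if }i=2).$$
   Context: Let $F=\bigoplus_{i=1}^l\mathbb R\varepsilon_i\oplus\mathbb Rb\oplus\mathbb Ra$ with symmetric bilinear form $I$, $I(\varepsilon_i,\varepsilon_j)=\delta_{ij}$, $\mathrm{rad}(I)=\mathbb Ra\oplus\mathbb Rb$. Put $B_s=\{\pm\varepsilon_i\}_{1\le i\le l}$, $B_m=\{\pm\varepsilon_i\pm\varepsilon_j\}_{1\le i<j\le l}$ (empty if $l=1$), $B_l=\{\pm2\varepsilon_i\}_{1\le i\le l}$, $\Lambda=\mathbb Za\oplus\mathbb Zb$, and for $S,L,E\subset\Lambda$ put $R(S,L,E)=(B_s+S)\cup(B_m+L)\cup(B_l+E)$. The (elliptic) root systems in the statement are $R(S,L,E)$ with triples: - $BC_l^{(1,2)}$: $(\Lambda,\Lambda,(1+2\mathbb Z)a+\mathbb Zb)$; - $BC_l^{(2,1)}$: $(\Lambda,\Lambda,\mathbb Za+(1+2\mathbb Z)b)$; - $BC_l^{(4,2)}$: $(\Lambda,\mathbb Za+2\mathbb Zb,(1+2\mathbb Z)a+4\mathbb Zb)$; - $BC_l^{(2,4)}$: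 $(\Lambda,2\mathbb Za+\mathbb Zb,4\mathbb Za+(1+2\mathbb Z)b)$; - $BC_l^{(2,2)\sigma}(1)$: $(\Lambda,\Lambda,(1+2\mathbb Z)a+2\mathbb Zb)$; - $BC_l^{(2,2)}(1)$: $(\Lambda,\Lambda,2\mathbb Za+(1+2\mathbb Z)b)$; - $BC_l^{(2,2)\sigma}(2)$: $(\Lambda,\mathbb Za+2\mathbb Zb,(1+2\mathbb Z)a+2\mathbb Zb)$; - $BC_l^{(2,2)}(2)$: $(\Lambda,2\mathbb Za+\mathbb Zb,2\mathbb Za+(1+2\mathbb Z)b)$. *)

(* Defs.v *)
From HB Require Import structures.
From mathcomp Require Import all_boot all_order all_algebra.
From mathcomp Require Import all_classical reals.

Set Implicit Arguments.
Unset Strict Implicit.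
Unset Printing Implicit Defensive.

Import Order.TTheory GRing.Theory Num.Theory.

Local Open Scope classical_set_scope.
Local Open Scope ring_scope.

Section EllipticBC.
Variables (R : realType) (l : nat).

(* Coordinates are ordered as in F = (+)_i R eps_i (+) R b (+) R a. *)
Definition F := 'rV[R]_(l + 2).

Definition eps (i : 'I_l) : F := delta_mx 0 (lshift 2 i).
Definition vb : F := delta_mx 0 (rshift l ord0).
Definition va : F := delta_mx 0 (rshift l ord_max).

Definition form (x y : F) : R :=
  \sum_(i < l) x 0 (lshift 2 i) * y 0 (lshift 2 i).

Definition radical : set F := [set x | forall y, form x y = 0].

Definition Bs : set F := [set x | exists (i : 'I_l) (s : bool),
  x = (-1) ^+ s *: eps i].
Definition Bm : set F := [set x | exists (i j : 'I_l) (s t : bool),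
  (i < j)%N /\ x = (-1) ^+ s *: eps i + (-1) ^+ t *: eps j].
Definition Bl : set F := [set x | exists (i : 'I_l) (s : bool),
  x = (-1) ^+ s *: (2 *: eps i)].

(* P a + Q b for P, Q subsets of Z *)
Definition lat (P Q : set int) : set F :=
  [set m%:~R *: va + n%:~R *: vb | m in P & n in Q].

Definition msum (A B : set F) : set F := [set x + y | x in A & y in B].

Definition RSLE (S L E : set F) : set F :=
  msum Bs S `|` msum Bm L `|` msum Bl E.

Definition root_iso (X Y : set F) : Prop :=
  exists f : {linear F -> F}, bijective f /\ f @` X = Y.

End EllipticBC.

Definition ZZ : set int := setT.
Definition mulZ (k : int) : set int := [set k * m | m in ZZ].
Definition oddZ : set int := [set 1 + 2 * m | m in ZZ].

Unset Implicit Arguments.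

Section Types.
Variables (R : realType) (l : nat).
Local Notation lat := (@lat R l).

Definition Lambda : set (F R l) := lat ZZ ZZ.

Definition R_BC_1_2 := RSLE Lambda Lambda (lat oddZ ZZ).
Definition R_BC_2_1 := RSLE Lambda Lambda (lat ZZ oddZ).
Definition R_BC_4_2 := RSLE Lambda (lat ZZ (mulZ 2)) (lat oddZ (mulZ 4)).
Definition R_BC_2_4 := RSLE Lambda (lat (mulZ 2) ZZ) (lat (mulZ 4) oddZ).
Definition R_BC_2_2s_1 := RSLE Lambda Lambda (lat oddZ (mulZ 2)).
Definition R_BC_2_2_1 := RSLE Lambda Lambda (lat (mulZ 2) oddZ).
Definition R_BC_2_2s_2 := RSLE Lambda (lat ZZ (mulZ 2)) (lat oddZ (mulZ 2)).
Definition R_BC_2_2_2 := RSLE Lambda (lat (mulZ 2) ZZ) (lat (mulZ 2) oddZ).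

End Types.

Set Implicit Arguments.

Section FormFacts.
Variables (R : realType) (l : nat).

Lemma form_sym (x y : F R l) : form x y = form y x.
Proof. by apply: eq_bigr => i _; rewrite mulrC. Qed.

Lemma form_linearl (y : F R l) : linear (fun x => form x y : R^o).
Proof.
move=> c u v; rewrite /form scaler_sumr -big_split /=.
by apply: eq_bigr => i _; rewrite !mxE mulrDl -mulrA.
Qed.

Lemma form_eps (i j : 'I_l) : form (eps R i) (eps R j) = (i == j)%:R.
Proof.
rewrite /form (bigD1 i) //= !mxE !eqxx (inj_eq (@lshift_inj _ _)) mul1r.
rewrite big1 ?addr0 // => k ki.
by rewrite !mxE (inj_eq (@lshift_inj _ _)) (negbTE ki) mul0r.
Qed.

Lemma radicalE :
  @radical R l = [set x | exists c d : R, x = c *: va R l + d *: vb R l].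
Proof.
apply/seteqP; split => [x rx|_ [c [d ->]] y] /=.
- exists (x 0 (rshift l ord_max)), (x 0 (rshift l ord0)).
  apply/rowP => k; rewrite !mxE eqxx /=.
  case: (split_ordP k) => j ->.
  + rewrite !eq_lrshift !mulr0 addr0.
    have := rx (eps R j); rewrite /form (bigD1 j) //= !mxE !eqxx mulr1 big1.
      by rewrite addr0.
    move=> i ij.
    by rewrite !mxE (inj_eq (@lshift_inj _ _)) (negbTE ij) mulr0.
  + rewrite !(inj_eq (@rshift_inj _ _)).
    case: j => [[|[|]]] //= p.
    * by rewrite mulr0 mulr1 add0r; congr (x 0 (rshift l _)); apply/val_inj.
    * by rewrite mulr0 mulr1 addr0; congr (x 0 (rshift l _)); apply/val_inj.
- rewrite /form big1 // => i _.
  by rewrite !mxE !eq_lrshift !mulr0 addr0 mul0r.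
Qed.

End FormFacts.

(* Main.v *)
Require Import Defs.
From HB Require Import structures.
From mathcomp Require Import all_boot all_order all_algebra.
From mathcomp Require Import all_classical reals.
From mathcomp Require Import perm.

(** In each of the four pairs, the triple (S, L, E) of the second root system
    is obtained from that of the first by exchanging the roles of [a] and [b].
    So one isomorphism serves all cases: the linear involution [swap_ab] of the
    ambient space that exchanges [a] and [b] and fixes every [eps i].  It
    preserves the finite parts [Bs], [Bm], [Bl] and maps [lat P Q] onto
    [lat Q P]; since a linear map commutes with the sums and unions that make
    up [RSLE], the theorem follows ([root_iso_swap_ab]). *)

Import GRing.Theory.
Local Open Scope classical_set_scope.
Local Open Scope ring_scope.

Section SwapRadical.
Variables (R : realType) (l : nat).
Implicit Types (A B S L E : set (F R l)) (P Q : set int).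

Lemma image_msum (f : {linear F R l -> F R l}) A B :
  f @` msum A B = msum (f @` A) (f @` B).
Proof.
apply/seteqP; split => [_ [_ [x Ax [y By <-]] <-]|].
  by exists (f x); [exists x | exists (f y); [exists y | rewrite linearD]].
move=> _ [_ [x Ax <-] [_ [y By <-] <-]].
by exists (x + y); [exists x => //; exists y | rewrite linearD].
Qed.

(** The linear involution exchanging the coordinates along [b] and [a],
    which are the last two coordinates of the row vector. *)
Definition swap_ab : {linear F R l -> F R l} :=
  col_perm (tperm (rshift l (@ord0 1)) (rshift l (@ord_max 1))).

Lemma swap_abK : involutive swap_ab.
Proof. by move=> x; apply/rowP => k; rewrite !mxE tpermK. Qed.

Lemma swap_ab_delta (k : 'I_(l + 2)) :
  swap_ab (delta_mx 0 k) =
  delta_mx 0 (tperm (rshift l ord0) (rshift l ord_max) k).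
Proof.
by apply/rowP => j; rewrite !mxE !eqxx /= (can2_eq (tpermK _ _) (tpermK _ _)).
Qed.

Lemma swap_ab_eps (i : 'I_l) : swap_ab (eps R i) = eps R i.
Proof. by rewrite swap_ab_delta tpermD // eq_rlshift. Qed.

Lemma swap_ab_va : swap_ab (va R l) = vb R l.
Proof. by rewrite swap_ab_delta tpermR. Qed.

Lemma swap_ab_vb : swap_ab (vb R l) = va R l.
Proof. by rewrite swap_ab_delta tpermL. Qed.

Lemma swap_ab_image_id A : (forall x, A x -> swap_ab x = x) -> swap_ab @` A = A.
Proof.
move=> Afix; apply/seteqP; split => [_ [x Ax <-]|x Ax]; first by rewrite Afix.
by exists x => //; apply: Afix.
Qed.

Lemma swap_ab_Bs : swap_ab @` @Bs R l = @Bs R l.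
Proof.
by apply: swap_ab_image_id => _ [i [s ->]]; rewrite linearZ /= swap_ab_eps.
Qed.

Lemma swap_ab_Bm : swap_ab @` @Bm R l = @Bm R l.
Proof.
apply: swap_ab_image_id => _ [i [j [s [t [_ ->]]]]].
by rewrite linearD !linearZ /= !swap_ab_eps.
Qed.

Lemma swap_ab_Bl : swap_ab @` @Bl R l = @Bl R l.
Proof.
apply: swap_ab_image_id => _ [i [s ->]].
by rewrite linearZ /= linearZ /= swap_ab_eps.
Qed.

Lemma swap_ab_lat P Q : swap_ab @` @lat R l P Q = @lat R l Q P.
Proof.
have sub P' Q' m n : P' m -> Q' n ->
    @lat R l Q' P' (swap_ab (m%:~R *: va R l + n%:~R *: vb R l)).
  move=> Pm Qn; exists n => //; exists m => //.
  by rewrite linearD !linearZ /= swap_ab_va swap_ab_vb addrC.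
apply/seteqP; split => [_ [_ [m Pm [n Qn <-]] <-]|_ [m Qm [n Pn <-]]].
  exact: sub.
by eexists; [exact: sub Qm Pn | exact: swap_abK].
Qed.

Lemma swap_ab_RSLE S L E :
  swap_ab @` RSLE S L E = RSLE (swap_ab @` S) (swap_ab @` L) (swap_ab @` E).
Proof.
by rewrite /RSLE !image_setU !image_msum swap_ab_Bs swap_ab_Bm swap_ab_Bl.
Qed.

Lemma root_iso_swap_ab (PS QS PL QL PE QE : set int) :
  root_iso (RSLE (@lat R l PS QS) (lat PL QL) (lat PE QE))
           (RSLE (@lat R l QS PS) (lat QL PL) (lat QE PE)).
Proof.
exists swap_ab; split; first exact: inv_bij swap_abK.
by rewrite swap_ab_RSLE !swap_ab_lat.
Qed.

End SwapRadical.

Theorem theorem6p1 :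
  forall (R : realType) (l : nat),
    ((1 <= l)%N -> root_iso (R_BC_1_2 R l) (R_BC_2_1 R l)) /\
    ((1 <= l)%N -> root_iso (R_BC_4_2 R l) (R_BC_2_4 R l)) /\
    ((2 <= l)%N -> root_iso (R_BC_2_2s_1 R l) (R_BC_2_2_1 R l)) /\
    ((1 <= l)%N -> root_iso (R_BC_2_2s_2 R l) (R_BC_2_2_2 R l)).
Proof.
move=> R l; split=> [_|]; first exact: root_iso_swap_ab.
split=> [_|]; first exact: root_iso_swap_ab.
by split=> _; exact: root_iso_swap_ab.
Qed.
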